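(* Let $R=K[x_1,\ldots,x_n]$ be a standard graded polynomial ring over a field $K$, and let $I$ be a proper stable monomial ideal in $R$ that is equigenerated in degree $d$. Then, for every $k \ge 1$, $$\mathrm{v}(\overline{I^k}) = \mathrm{v}(I^k) = kd - 1.$$
   Context: For a monomial $x^A\in R$ write $\mu(x^A)=\max\{i : x_i\mid x^A\}$. A monomial ideal $I\subseteq R$ is stable if for every monomial $x^A\in I$ and every $i<\mu(x^A)$ one has $x_i\cdot \frac{x^A}{x_{\mu(x^A)}}\in I$. A (nonzero) monomial ideal is equigenerated in degree $d$ if all its minimal monomial generators have degree $d$. For a proper homogeneous ideal $I\subseteq R$, the v-number of $I$ is $$\mathrm{v}(I)=\min\{d\ge 0 : \text{there exist } f\in R_d \text{ and } \mathfrak p\in\operatorname{Ass}(I) \text{ such that } (I:f)=\mathfrak p\},$$ where $R_d$ is the space of homogeneous polynomials of degree $d$, $(I:f)=\{g\in R: gf\in I\}$, and $\operatorname{Ass}(I)$ is the set of associated primes of $R/I$. The integral closure $\overline{I}$ of an ideal $I$ is the ideal of all $x\in R$ satisfying an equation $x^m+a_1x^{m-1}+\cdots+a_m=0$ with $m\ge 1$ and $a_i\in I^i$. *)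

(* Defs.v *)
From mathcomp Require Import all_boot all_order all_algebra.
From mathcomp Require Import boolp classical_sets.
From mathcomp Require Import mpoly.

Set Implicit Arguments.
Unset Strict Implicit.
Unset Printing Implicit Defensive.

Import GRing.Theory.
Local Open Scope classical_set_scope.
Local Open Scope ring_scope.

(* Ideals are classical subsets of the ring: the ideal predicates of
   ring_quotient are boolean and only cover proper ideals. *)
Section Ideals.
Variable R : comNzRingType.
Implicit Types I p S : set R.

Definition is_ideal I : Prop :=
  [/\ I 0, (forall f g, I f -> I g -> I (f + g))
    & forall r f, I f -> I (r * f)].

Definition is_proper_ideal I : Prop := is_ideal I /\ ~ I 1.

Definition is_prime_ideal p : Prop :=
  is_proper_ideal p /\ forall f g, p (f * g) -> p f \/ p g.

Definition ideal_gen S : set R := smallest is_ideal S.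

(* For k = 0 the only product is the empty one, so I^0 is the whole ring. *)
Definition ideal_pow I k : set R :=
  ideal_gen [set f | exists a : 'I_k -> R,
                       (forall i, I (a i)) /\ f = \prod_(i < k) a i].

Definition colon I f : set R := [set g | I (g * f)].

(* Ass(R/I): the annihilator in R/I of the class of f is (I : f). *)
Definition associated_primes I : set (set R) :=
  [set p | is_prime_ideal p /\ exists f, p = colon I f].

Definition integral_closure I : set R :=
  [set x | exists m (a : nat -> R),
     [/\ (1 <= m)%N, (forall i, (1 <= i <= m)%N -> ideal_pow I i (a i))
       & x ^+ m + \sum_(1 <= i < m.+1) a i * x ^+ (m - i) = 0]].

End Ideals.

Section PolynomialIdeals.
Variables (n : nat) (K : fieldType).
Local Notation R := {mpoly K[n]}.
Implicit Types (I : set R) (m : 'X_{1..n}).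

Definition monomial_ideal I : Prop :=
  exists A : set 'X_{1..n}, I = ideal_gen [set ('X_[m] : R) | m in A].

(* Variables are numbered from 1 here, so 'X_i with i : 'I_n has number i.+1,
   and mu 0 = 0 for the monomial 1. *)
Definition mu m : nat := \max_(i < n | (0 < m i)%N) i.+1.

(* The index j is the one of the last variable occurring in 'X_[m]. *)
Definition stable I : Prop :=
  forall m, I 'X_[m] -> forall i j : 'I_n, mu m = j.+1 -> (i < j)%N ->
    I ('X_i * 'X_[(m - U_(j))%MM]).

Definition min_generator I m : Prop :=
  I 'X_[m] /\ forall m', I 'X_[m'] -> (m' <= m)%MM -> m' = m.

Definition equigenerated I (d : nat) : Prop :=
  I <> [set 0] /\ forall m, min_generator I m -> mdeg m = d.

Definition v_degrees I : set nat :=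
  [set d | exists f : R, f \is d.-homog /\ associated_primes I (colon I f)].

(* v(I) = v, as a relation: it holds for no v if the minimum does not exist. *)
Definition is_vnumber I (v : nat) : Prop :=
  v_degrees I v /\ forall d, v_degrees I d -> (v <= d)%N.

End PolynomialIdeals.

(* Main.v *)
(* Let j be the index of the last variable occurring in some minimal generator
   of I, let 'X_[m] be a minimal generator involving 'X_j, and let W_a be the
   ideal of the polynomials all of whose monomials have degree at least a in the
   variables up to 'X_j.  All minimal generators of I have that degree d, so I^k
   lies in W_(kd), and so does its integral closure because initial forms
   multiply in a domain.  For J between I^k and W_(kd) and
   f = 'X_[m] ^+ k / 'X_j, stability puts 'X_i * f in I^k for i <= j, whence
   (J : f) = W_1, which is the prime generated by the variables up to 'X_j.
   Conversely, a prime (J : f) contains a monomial, hence a variable 'X_i, and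
   'X_i * f in J forces deg f + 1 >= kd. *)

Require Import Defs.
From HB Require Import structures.
From mathcomp Require Import all_boot all_order all_algebra.
From mathcomp Require Import boolp classical_sets.
From mathcomp Require Import mpoly.

Set Implicit Arguments.
Unset Strict Implicit.
Unset Printing Implicit Defensive.

Import GRing.Theory.
Local Open Scope classical_set_scope.
Local Open Scope ring_scope.

(** * Ideals, their powers and their integral closures *)

Section IdealFacts.
Variable R : comNzRingType.
Implicit Types (I J S : set R) (f g : R).

Lemma ideal_gen_is_ideal S : is_ideal (ideal_gen S).
Proof.
split=> [J [[J0 _ _] _] //|f g If Ig J JP|r f If J JP].
  by have [[_ JD _] _] := JP; exact: JD (If _ JP) (Ig _ JP).
by have [[_ _ JM] _] := JP; exact: JM (If _ JP).
Qed.

Lemma mem_ideal_pow I k (a : 'I_k -> R) :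
  (forall i, I (a i)) -> ideal_pow I k (\prod_(i < k) a i).
Proof. by move=> Ia; apply: sub_gen_smallest; exists a. Qed.

(** This shape fits ['X_[m] ^+ k.+1] with one factor ['X_[m]] altered by a stability move. *)
Lemma ideal_powS I k f g : I f -> I g -> ideal_pow I k.+1 (f * g ^+ k).
Proof.
move=> If Ig; pose a (i : 'I_k.+1) := if i == ord0 then f else g.
have Ia i : I (a i) by rewrite /a; case: ifP.
by have := mem_ideal_pow Ia; rewrite big_ord_recl /= prodr_const card_ord.
Qed.

Lemma ideal_pow_is_ideal I k : is_ideal (ideal_pow I k).
Proof. exact: ideal_gen_is_ideal. Qed.

Lemma ideal_sum J (T : eqType) (r : seq T) (F : T -> R) :
  is_ideal J -> (forall i, i \in r -> J (F i)) -> J (\sum_(i <- r) F i).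
Proof. by move=> [J0 JD _] JF; rewrite big_seq; elim/big_ind: _. Qed.

Lemma sub_integral_closure J : J `<=` integral_closure J.
Proof.
(* The equation of integral dependence is the linear one, [f + (- f) = 0]. *)
move=> f Jf; exists 1%N, (fun=> - f); split=> // [i /andP[i_ge1 i_le1]|].
  have -> : i = 1%N by apply/eqP; rewrite eqn_leq i_le1.
  have := @mem_ideal_pow J 1 (fun=> f) (fun=> Jf).
  have [_ _ JM] := ideal_pow_is_ideal J 1.
  by rewrite big_ord1 => /(JM (-1)); rewrite mulN1r.
by rewrite big_nat1 subnn mulr1 expr1 subrr.
Qed.

End IdealFacts.

Lemma mfMn (n : nat) (w : measure n) (m : 'X_{1..n}) k :
  w (m *+ k)%MM = (k * w m)%N.
Proof. by elim: k => [|k IHk]; rewrite ?mulm0n ?mf0 // mulmS mfD IHk mulSn. Qed.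

(** * The filtration of the polynomial ring by an additive weight on monomials *)

Section WeightFiltration.
Variables (n : nat) (K : fieldType) (w : measure n).
Local Notation R := {mpoly K[n]}.
Implicit Types (f g : R) (I J : set R).

Definition weight_ge a : set R :=
  [set f | forall m, m \in msupp f -> (a <= w m)%N].

Lemma weight_ge0 f : weight_ge 0 f.
Proof. by []. Qed.

Lemma weight_geW a b f : (a <= b)%N -> weight_ge b f -> weight_ge a f.
Proof. by move=> le_ab Wf m /Wf; apply: leq_trans. Qed.

Lemma weight_geM a b f g :
  weight_ge a f -> weight_ge b g -> weight_ge (a + b) (f * g).
Proof.
move=> Wf Wg m /msuppM_le/allpairsP[[m1 m2] /= [fm1 gm2 ->]].
by rewrite mfD leq_add ?Wf ?Wg.
Qed.

Lemma weight_ge_ideal a : is_ideal (weight_ge a).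
Proof.
split=> [m|f g Wf Wg m|r f Wf]; first by rewrite msupp0.
  by move/msuppD_le; rewrite mem_cat => /orP[/Wf|/Wg].
exact: (@weight_geM 0).
Qed.

Lemma weight_geD a f g :
  weight_ge a f -> weight_ge a g -> weight_ge a (f + g).
Proof. by have [_ WD _] := weight_ge_ideal a; apply: WD. Qed.

Lemma weight_geN a f : weight_ge a f -> weight_ge a (- f).
Proof.
by have [_ _ WM] := weight_ge_ideal a; move/(WM (-1)); rewrite mulN1r.
Qed.

Lemma weight_geX a f k : weight_ge a f -> weight_ge (k * a) (f ^+ k).
Proof.
move=> Wf; elim: k => [|k IHk]; first exact: weight_ge0.
by rewrite exprS mulSn; apply: weight_geM.
Qed.

Lemma weight_ge_homog a f : f \is @ishomog1 n K a w -> weight_ge a f.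
Proof. by move/dhomogP=> hf m /hf->. Qed.

Lemma weight_ge_homog_eq0 a f :
  f \is @ishomog1 n K a w -> weight_ge a.+1 f -> f = 0.
Proof.
move/dhomogP=> hf Wf; apply/eqP; rewrite -msupp_eq0.
case E: (msupp f) => [//|m s]; have fm : m \in msupp f by rewrite E mem_head.
by have := Wf m fm; rewrite hf // ltnn.
Qed.

(** Subtracting the component of weight [a] kills exactly the terms of weight [a]; the remaining
    ones, of weight at least [a], have weight at least [a.+1]. *)
Lemma weight_ge_subpihomog a f :
  weight_ge a f -> weight_ge a.+1 (f - pihomog w a f).
Proof.
move=> Wf m; rewrite mcoeff_msupp mcoeffB.
have -> : (pihomog w a f)@_m = if w m == a then f@_m else 0.
  rewrite pihomogE big_mkcond raddf_sum /=.
  case fm: (m \in msupp f); last first.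
    rewrite (memN_msupp_eq0 (negbT fm)) if_same big_seq big1 // => m' fm'.
    case: ifP => _; last by rewrite mcoeff0.
    rewrite mcoeffZ mcoeffX; case: eqP fm' => [->|]; first by rewrite fm.
    by rewrite mulr0.
  rewrite (bigD1_seq m) ?msupp_uniq //= big1 ?addr0 => [|m' ne_m'].
    by case: ifP; rewrite ?mcoeff0 // mcoeffZ mcoeffX eqxx mulr1.
  by case: ifP; rewrite ?mcoeff0 // mcoeffZ mcoeffX (negPf ne_m') mulr0.
case: (w m =P a) => [_|/eqP ne]; first by rewrite subrr eqxx.
by rewrite subr0 -mcoeff_msupp ltn_neqAle eq_sym ne => /Wf.
Qed.

Lemma weight_ge_pihomog_eq0 a f :
  weight_ge a f -> pihomog w a f = 0 -> weight_ge a.+1 f.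
Proof. by move=> /weight_ge_subpihomog Wf f0; rewrite f0 subr0 in Wf. Qed.

(** In the application [f0] and [g0] are initial forms, but only the congruences modulo higher
    weight matter. *)
Lemma weight_geM_initial a b f g f0 g0 :
    weight_ge a f0 -> weight_ge b g ->
    weight_ge a.+1 (f - f0) -> weight_ge b.+1 (g - g0) ->
  weight_ge (a + b).+1 (f * g - f0 * g0).
Proof.
move=> Wf0 Wg Wf Wg0.
have -> : f * g - f0 * g0 = (f - f0) * g + f0 * (g - g0).
  by rewrite mulrBl mulrBr addrA subrK.
by apply: weight_geD; [rewrite -addSn|rewrite -addnS]; apply: weight_geM.
Qed.

Lemma weight_geX_initial a f f0 k :
    weight_ge a f -> weight_ge a f0 -> weight_ge a.+1 (f - f0) ->
  weight_ge (k * a).+1 (f ^+ k - f0 ^+ k).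
Proof.
move=> Wf Wf0 Wff0; elim: k => [|k IHk].
  by rewrite !expr0 subrr; have [] := weight_ge_ideal (0 * a).+1.
rewrite !exprS mulSn; apply: weight_geM_initial => //.
exact: weight_geX.
Qed.

(* Initial forms multiply and the polynomial ring is a domain. *)
Lemma weight_geX_cancel a f k :
  weight_ge a f -> weight_ge (k * a).+1 (f ^+ k) -> weight_ge a.+1 f.
Proof.
move=> Wf Wfk; apply: weight_ge_pihomog_eq0 => //.
set f0 := pihomog w a f; have hf0 : f0 \is @ishomog1 n K a w by apply: pihomogP.
have Wf0k : weight_ge (k * a).+1 (f0 ^+ k).
  rewrite -[f0 ^+ k](subKr (f ^+ k)); apply: weight_geD => //.
  apply/weight_geN/weight_geX_initial => //; first exact: weight_ge_homog.
  exact: weight_ge_subpihomog.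
have : f0 ^+ k = 0.
  by apply: (weight_ge_homog_eq0 _ Wf0k); rewrite mulnC; apply: dhomogMn.
by move/eqP; rewrite expf_eq0 => /andP[_ /eqP].
Qed.

(** The components of weight 0 multiply: if [f * g] has none, the product of those of [f] and [g] is
    both of weight 0 and in [weight_ge 1], hence zero, and one of them vanishes. *)
Lemma weight_ge1_prime : is_prime_ideal (weight_ge 1).
Proof.
split=> [|f g Wfg].
  split; first exact: weight_ge_ideal.
  by move/(_ 0%MM); rewrite msupp1 mem_head mf0 => /(_ isT).
set f0 := pihomog w 0 f; set g0 := pihomog w 0 g.
have [hf0 hg0] : f0 \is @ishomog1 n K 0 w /\ g0 \is @ishomog1 n K 0 w.
  by split; apply: pihomogP.
have Wfg0 : weight_ge 1 (f0 * g0).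
  rewrite -[f0 * g0](subKr (f * g)); apply: weight_geD => //.
  by apply/weight_geN/(@weight_geM_initial 0 0) => //;
    apply: weight_ge_subpihomog.
have /eqP : f0 * g0 = 0 := weight_ge_homog_eq0 (dhomogM hf0 hg0) Wfg0.
rewrite mulf_eq0 => /orP[] /eqP h0; [left|right];
  exact: weight_ge_pihomog_eq0.
Qed.

Lemma ideal_pow_weight_ge I a k :
  I `<=` weight_ge a -> ideal_pow I k `<=` weight_ge (k * a).
Proof.
move=> WI; apply: smallest_sub; first exact: weight_ge_ideal.
move=> _ [b [Ib ->]]; elim: k b Ib => [|k IHk] b Ib; first exact: weight_ge0.
rewrite big_ord_recl mulSn; apply: weight_geM; first exact/WI/Ib.
by apply: IHk => i; apply: Ib.
Qed.

(* If f has weight at least v < a, an equation of integral dependence puts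
   f ^+ l in weight > l * v, so the weight of f can be improved to v + 1. *)
Lemma integral_closure_weight_ge J a :
  J `<=` weight_ge a -> integral_closure J `<=` weight_ge a.
Proof.
move=> WJ f [l [b [l_gt0 Jb /eqP]]]; rewrite addr_eq0 => /eqP fl.
suff H v : (v <= a)%N -> weight_ge v f by apply: H.
elim: v => [_|v IHv lt_va]; first exact: weight_ge0.
have {IHv} Wf := IHv (ltnW lt_va); apply: (weight_geX_cancel (k := l)) => //.
rewrite fl; apply: weight_geN; apply: ideal_sum; first exact: weight_ge_ideal.
move=> i; rewrite mem_index_iota ltnS => il.
have := weight_geM (ideal_pow_weight_ge WJ (Jb i il))
  (weight_geX (k := (l - i)%N) Wf).
have /andP[i_gt0 le_il] := il.
apply: weight_geW; rewrite -[X in (X * v < _)%N](subnKC le_il) mulnDl.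
by rewrite ltn_add2r ltn_mul2l i_gt0.
Qed.

End WeightFiltration.

(** * The weight counting the degree in the variables up to ['X_j] *)

Section InitialVariables.
Variables (n : nat) (j : 'I_n).

Definition init_weight (m : 'X_{1..n}) : nat := \sum_(i < n | (i <= j)%N) m i.

Fact init_weight0 : init_weight 0%MM = 0%N.
Proof. by rewrite /init_weight big1 // => i _; rewrite mnm0E. Qed.

Fact init_weightD :
  {morph init_weight : m1 m2 / (m1 + m2)%MM >-> (m1 + m2)%N}.
Proof.
move=> m1 m2; rewrite /init_weight -big_split /=.
by apply: eq_bigr => i _; rewrite mnmDE.
Qed.

HB.instance Definition _ :=
  isMeasure.Build n init_weight init_weight0 init_weightD.

Lemma init_weight_le_mdeg m : (init_weight m <= mdeg m)%N.
Proof.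
rewrite mdegE /init_weight big_mkcond /=.
by apply: leq_sum => i _; case: ifP.
Qed.

Lemma init_weight_mdeg m : (mu m <= j.+1)%N -> init_weight m = mdeg m.
Proof.
move=> mu_m; rewrite mdegE /init_weight big_mkcond /=.
apply: eq_bigr => i _; case: ifP => // /negbT; rewrite -ltnNge => lt_ji.
apply/esym/eqP; rewrite -leqn0 leqNgt; apply/negP => mi_gt0.
have : (i.+1 <= mu m)%N by apply: (@leq_bigmax_cond _ _ (fun i : 'I_n => i.+1)).
by move/leq_trans/(_ mu_m); rewrite ltnS leqNgt lt_ji.
Qed.

Lemma init_weight_gt0P m :
  (0 < init_weight m)%N -> exists2 i : 'I_n, (i <= j)%N & (0 < m i)%N.
Proof.
rewrite lt0n sum_nat_eq0 negb_forall => /existsP[i].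
by rewrite negb_imply -lt0n => /andP[]; exists i.
Qed.

End InitialVariables.

(** * Monomial ideals and their minimal generators *)

Section Monomials.
Variables (n : nat) (K : fieldType).
Local Notation R := {mpoly K[n]}.
Implicit Types (I : set R) (m : 'X_{1..n}).

Lemma U1_le i m : (0 < m i)%N -> (U_(i) <= m)%MM.
Proof.
by move=> mi; apply/mnm_lepP => i'; rewrite mnm1E; case: eqP => [<-|].
Qed.

(** Induction on the degree: a monomial of [I] that is not minimal has a proper divisor in [I], of
    smaller degree. *)
Lemma le_min_generator I m : I 'X_[m] ->
  exists2 m', min_generator I m' & (m' <= m)%MM.
Proof.
have [e] := ubnP (mdeg m); elim: e m => // e IHe m lt_me Im.
have [minm|] := pselect (min_generator I m).
  by exists m; rewrite ?lepm_refl.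
move/not_andP=> [//|/existsNP[m' /not_implyP[Im' /not_implyP[le_m'm ne]]]].
have [|//|m1 min1 le1] := IHe m'; last first.
  by exists m1 => //; apply: lepm_trans le_m'm.
rewrite ltnS in lt_me; apply: leq_trans lt_me.
rewrite -(submK le_m'm) mdegD -[X in (X < _)%N]add0n ltn_add2r.
rewrite lt0n mdeg_eq0; apply/eqP => m0; apply: ne.
by rewrite -(submK le_m'm) m0 add0m.
Qed.

Lemma monomial_ideal_sub I J : is_ideal J -> monomial_ideal I ->
  (forall m, min_generator I m -> J 'X_[m]) -> I `<=` J.
Proof.
move=> Jid [A IA] Jmin; rewrite IA; apply: smallest_sub => // _ [m Am <-].
have [|m' /Jmin Jm' le_m'm] := @le_min_generator I m.
  by rewrite IA; apply: sub_gen_smallest; exists m.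
have [_ _ JM] := Jid.
by rewrite -(submK le_m'm) mpolyXD; apply: JM.
Qed.

Lemma exists_max_mu_generator I : is_ideal I -> monomial_ideal I ->
    I <> [set 0] ->
  exists2 m, min_generator I m &
    forall m', min_generator I m' -> (mu m' <= mu m)%N.
Proof.
move=> [I0 _ _] monI ne0.
pose P s := `[< exists2 m, min_generator I m & mu m = s >].
have exP : exists s, P s.
  (* Without minimal generators, [I] would be contained in the zero ideal. *)
  apply: contrapT => nP; apply: ne0; apply/seteqP; split=> [|_ ->//].
  apply: monomial_ideal_sub => // [|m minm].
    split=> // [f g -> ->|r f ->]; first by rewrite addr0.
    by rewrite /= mulr0.
  by case: nP; exists (mu m); apply/asboolP; exists m.
have ubP s : P s -> (s <= n)%N.
  by move/asboolP => [m _ <-]; apply/bigmax_leqP.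
have [s /asboolP[m minm <-] maxs] := ex_maxnP exP ubP.
by exists m => // m' minm'; apply/maxs/asboolP; exists m'.
Qed.

Lemma mu_ord m : (0 < mdeg m)%N -> exists2 j : 'I_n, mu m = j.+1 & (0 < m j)%N.
Proof.
rewrite mdegE lt0n sum_nat_eq0 negb_forall => /existsP[i /= mi].
have [|j mj muE] :=
  @eq_bigmax_cond _ [pred i : 'I_n | (0 < m i)%N] (fun i => i.+1).
  by apply/card_gt0P; exists i; rewrite inE lt0n.
by exists j; [exact: muE|exact: mj].
Qed.

(** A monomial is a product of variables, and the empty product 1 is not in [p]. *)
Lemma prime_ideal_variable (p : set R) m :
  is_prime_ideal p -> p 'X_[m] -> exists i, p 'X_i.
Proof.
move=> [[_ p1] pM]; rewrite mpolyXE_id => pm; apply: contrapT => np; move: pm.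
elim/big_rec: _ => // i f _ IHf /pM[|//].
elim: (m i) => [|e IHe]; first by rewrite expr0.
by rewrite exprS => /pM[pi|//]; apply: np; exists i.
Qed.

End Monomials.

(** * The v-number of an ideal lying between [P] and a step of the filtration *)

Section VNumber.
Variables (n : nat) (K : fieldType) (w : measure n).
Hypothesis w_le_mdeg : forall m, (w m <= mdeg m)%N.
Variables (P J : set {mpoly K[n]}) (a : nat).
Hypotheses (P_ideal : is_ideal P) (PJ : P `<=` J) (JW : J `<=` weight_ge w a).

Lemma v_degrees_lower_bound m e : P 'X_[m] -> v_degrees J e -> (a - 1 <= e)%N.
Proof.
have [P0 _ PM] := P_ideal => Pm [f [/dhomogP hf [primef _]]].
have [i Jif] : exists i, colon J f 'X_i.
  apply: (@prime_ideal_variable _ _ _ m primef); apply: PJ.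
  by rewrite mulrC; apply: PM.
(* If [f] were zero, the colon ideal would contain 1 and not be prime. *)
have [m' fm'] : exists m', m' \in msupp f.
  case E: (msupp f) => [|m' s]; last by exists m'; rewrite mem_head.
  have [[_ not1] _] := primef; case: not1.
  by rewrite /colon /= (msuppnil0 E) mulr0; apply: PJ.
have := JW Jif (m := (U_(i) + m')%MM).
rewrite mulrC mcoeff_msupp mcoeffMX -mcoeff_msupp => /(_ fm') Wm.
rewrite leq_subLR -(hf m' fm') -(mdeg1 i) -mdegD.
exact: leq_trans Wm (w_le_mdeg _).
Qed.

Lemma colon_monomial_weight_ge u :
    (0 < a)%N -> w u = (a - 1)%N ->
    (forall i, (0 < w U_(i)%MM)%N -> P ('X_i * 'X_[u])) ->
  colon J 'X_[u] = weight_ge w 1.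
Proof.
have [P0 PD PM] := P_ideal => a_gt0 wu Pu; apply/seteqP; split=> g.
  move=> Jgu m gm; have := JW Jgu (m := (u + m)%MM).
  rewrite mcoeff_msupp mcoeffMX -mcoeff_msupp => /(_ gm).
  (* As [a > 0], the bound [a <= (a - 1) + w m] says that [w m] is positive. *)
  by rewrite mfD wu -leq_subLR subKn.
(* Conversely, each monomial of [g] is divisible by a variable of positive weight, which already
   carries ['X_[u]] into [P]. *)
move=> Wg; apply: PJ; rewrite (mpolyE g) mulr_suml.
apply: ideal_sum => // m /Wg; rewrite mfE lt0n sum_nat_eq0 negb_forall.
move=> /existsP[i /=]; rewrite muln_eq0 negb_or -!lt0n => /andP[mi wi].
rewrite -[in 'X_[m]](submK (U1_le mi)) mpolyXD -scalerAl -mulrA -mul_mpolyC.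
by apply/PM/PM/Pu.
Qed.

(** The monomial ['X_[u]] attains the value. The index [i] serves the lower bound, by providing the
    monomial ['X_i * 'X_[u]] of [P]. *)
Lemma vnumber_sandwich u i :
    (0 < a)%N -> w u = (a - 1)%N -> mdeg u = (a - 1)%N -> (0 < w U_(i)%MM)%N ->
    (forall i, (0 < w U_(i)%MM)%N -> P ('X_i * 'X_[u])) ->
  is_vnumber J (a - 1).
Proof.
move=> a_gt0 wu du wi Pu; split=> [|e].
  exists 'X_[u]; split; first by rewrite dhomogX; apply/eqP.
  split; last by exists 'X_[u].
  by rewrite colon_monomial_weight_ge //; apply: weight_ge1_prime.
by apply: (@v_degrees_lower_bound (U_(i) + u)%MM); rewrite mpolyXD; apply: Pu.
Qed.

End VNumber.

(** * The v-numbers of the powers of [I] and of their integral closures *)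

Theorem corollary3p8 (K : fieldType) (n d : nat) (I : set {mpoly K[n]})
    (I_proper : is_proper_ideal I) (I_monomial : monomial_ideal I)
    (I_stable : stable I) (I_equigen : equigenerated I d)
    (k : nat) (k_ge1 : (1 <= k)%N) :
  is_vnumber (integral_closure (ideal_pow I k)) (k * d - 1)%N /\
  is_vnumber (ideal_pow I k) (k * d - 1)%N.
Proof.
have [[I_ideal I1] [I_neq0 genI]] := (I_proper, I_equigen).
have [m minm max_m] := exists_max_mu_generator I_ideal I_monomial I_neq0.
have [[Im _] dm] := (minm, genI m minm).
have d_gt0 : (0 < d)%N.
  rewrite lt0n -dm mdeg_eq0; apply/eqP => m0.
  by apply: I1; rewrite -mpolyX0 -m0.
have [j mu_m mj] : exists2 j : 'I_n, mu m = j.+1 & (0 < m j)%N.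
  by apply: mu_ord; rewrite dm.
(* By the maximality of [mu m], no minimal generator involves a variable after ['X_j], so its weight
   is its full degree [d]. *)
have IW : I `<=` weight_ge (init_weight j) d.
  apply: monomial_ideal_sub => // [|m' minm']; first exact: weight_ge_ideal.
  move=> _ /mem_msuppXP <-; rewrite -(genI m' minm').
  by rewrite /= init_weight_mdeg // -mu_m max_m.
have wU i : (0 < init_weight j U_(i)%MM)%N -> (i <= j)%N.
  case/init_weight_gt0P => i' le_i'j; rewrite mnm1E.
  by case: eqP => // ->.
have IkW : ideal_pow I k `<=` weight_ge (init_weight j) (k * d).
  exact: ideal_pow_weight_ge.
(* The exponent of ['X_[m] ^+ k / 'X_j], with ['X_j] removed from one of the [k] copies of
   ['X_[m]]. *)
pose u := ((m - U_(j)) + m *+ k.-1)%MM.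
have le_Um := U1_le mj.
have Uju : (U_(j) + u = m *+ k)%MM.
  by rewrite /u addmA [(U_(j) + _)%MM]addmC (submK le_Um) -mulmS prednK.
have wm : init_weight j m = d by rewrite init_weight_mdeg ?mu_m.
have wUj : init_weight j U_(j)%MM = 1%N.
  apply/eqP; rewrite eqn_leq -{1}(mdeg1 j) init_weight_le_mdeg /=.
  by rewrite /init_weight (bigD1 j) //= mnm1E eqxx.
have du : mdeg u = (k * d - 1)%N.
  have := congr1 mdeg Uju; rewrite mdegD mdeg1 mdegMn dm mulnC => <-.
  by rewrite addKn.
have wu : init_weight j u = (k * d - 1)%N.
  have := congr1 (init_weight j) Uju; rewrite init_weightD wUj mfMn /= wm => <-.
  by rewrite addKn.
have Pu i : (0 < init_weight j U_(i)%MM)%N -> ideal_pow I k ('X_i * 'X_[u]).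
  move/wU => le_ij; rewrite /u mpolyXD mulrA -mpolyXn.
  (* For [i = j] this is ['X_[m]] itself; for [i < j] it is the stability of [I]. *)
  have Ii : I ('X_i * 'X_[m - U_(j)]).
    move: le_ij; rewrite leq_eqVlt => /orP[/eqP/val_inj->|lt_ij].
      by rewrite mulrC -mpolyXD submK.
    exact: I_stable lt_ij.
  by have := ideal_powS (k := k.-1) Ii Im; rewrite prednK.
have kd_gt0 : (0 < k * d)%N by rewrite muln_gt0 k_ge1.
have wUj_gt0 : (0 < init_weight j U_(j)%MM)%N by rewrite wUj.
(* Both claims take [P] to be [I^k]; only the upper ideal [J] differs. *)
split; apply: (vnumber_sandwich (init_weight_le_mdeg j)
  (ideal_pow_is_ideal I k) _ _ kd_gt0 wu du (i := j)) => //.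
- exact: sub_integral_closure.
- exact: integral_closure_weight_ge.
Qed.
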